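(* Let $(F,E,L)$ be a $\sigma$-admissible triple and $M$ an $L$-trivial $\varphi$-module over $E$ of dimension $r$, with $\Gamma$, $\Gamma_M$ and $\pi_M$ as in the context. Then $\pi_M:\Gamma\to\Gamma_M$ is a closed immersion of affine $F$-schemes.
   Context: A $\sigma$-admissible triple $(F,E,L)$ consists of a positive integer $d$, rings $F\subset E\subset L$ with $F,E$ fields and $L=\prod_{l\in\mathbb{Z}/d}L_l$ a finite product of fields, and a ring endomorphism $\sigma:L\to L$ with $\sigma(E)\subset E$, $\sigma(L_l)\subset L_{l+1}$, $F=E^\sigma=L^\sigma$, and $L$ separable over $E$. A $\varphi$-module over $E$ is an $E$-vector space with additive $\varphi$, $\varphi(ax)=\sigma(a)\varphi(x)$; $V(M):=(L\otimes_EM)^{\varphi}$ ($\varphi$ acting as $\sigma\otimes\varphi$); $M$ is $L$-trivial if finite-dimensional and $L\otimes_FV(M)\to L\otimes_EM$ is bijective. $L$-trivial modules form a neutral Tannakian category over $F$ with fiber functor $V$; $\mathcal T_M$ is the Tannakian subcategory generated by $M$ and $\Gamma_M$ the Tannakian Galois group of $(\mathcal T_M,V)$. Fix an $E$-basis $\mathbf m$ of $M$, $\Phi\in\mathrm{GL}_r(E)$ with $\varphi\mathbf m=\Phi\mathbf m$, $\Psi\in\mathrm{GL}_r(L)$ with $\sigma\Psi=\Phi\Psi$. With $X$ an $r\times r$ matrix of indeterminates and $\Delta=\det X$: $\Sigma:=E[\Psi,\det\Psi^{-1}]$, $\Gamma:=\mathrm{Spec}\,F[X,\Delta^{-1}]/\ker(X\mapsto(\Psi_{ij}\otimes1)^{-1}(1\otimes\Psi_{ij})\in\mathrm{GL}_r(L\otimes_EL))$.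 For $N\in\mathcal T_M$ and an $F$-algebra $R$, the natural map $(R\otimes_F\Sigma)\otimes_FV(N)\to(R\otimes_F\Sigma)\otimes_EN$ is bijective and $\gamma\in\Gamma(R)$ acts on $R\otimes_FV(N)$ by restricting $h(\Psi)\otimes x\mapsto h(\Psi\gamma)\otimes x$; this gives a tensor functor $\mathcal T_M\to\mathrm{Rep}(\Gamma,F)$ compatible with the forgetful functors, and $\pi_M:\Gamma\to\Gamma_M$ is the homomorphism inducing it by Tannakian duality. *)

(* Defs.v *)
From HB Require Import structures.
From mathcomp Require Import mpoly.
From mathcomp Require Import all_boot all_order all_algebra.
From mathcomp Require Import boolp.

Set Implicit Arguments.
Unset Strict Implicit.
Unset Printing Implicit Defensive.

Import GRing.Theory.
Local Open Scope ring_scope.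
Local Open Scope quotient_scope.

(* Tensor products over a commutative ring: formal sums of pairs, two sums
   being identified when every balanced map to an abelian group agrees on
   them. *)

Section Tensor.
Variables (K : comPzRingType) (A B : lmodType K).
Implicit Types (a : A) (b : B) (s t : seq (A * B)).

Definition balanced (W : zmodType) (f : A -> B -> W) : Prop :=
  [/\ forall a a' b, f (a + a') b = f a b + f a' b,
      forall a b b', f a (b + b') = f a b + f a b'
    & forall c a b, f (c *: a) b = f a (c *: b)].

Definition formal_eval (W : zmodType) (f : A -> B -> W) s : W :=
  \sum_(p <- s) f p.1 p.2.

Definition tens_rel s t : bool :=
  `[< forall (W : zmodType) (f : A -> B -> W),
        balanced f -> formal_eval f s = formal_eval f t >].

Lemma tens_rel_refl : reflexive tens_rel.
Proof. by move=> s; apply/asboolP. Qed.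

Lemma tens_rel_sym : symmetric tens_rel.
Proof. by move=> s t; apply/asboolP/asboolP => st W f /st. Qed.

Lemma tens_rel_trans : transitive tens_rel.
Proof.
move=> t s u /asboolP st /asboolP tu; apply/asboolP=> W f fP.
by rewrite st ?tu.
Qed.

Canonical tens_equiv : equiv_rel (seq (A * B)) :=
  EquivRel tens_rel tens_rel_refl tens_rel_sym tens_rel_trans.

Definition tens : Type := {eq_quot tens_equiv}.
HB.instance Definition _ := Choice.copy tens {eq_quot tens_equiv}.
HB.instance Definition _ := EqQuotient.copy tens {eq_quot tens_equiv}.

(* Meaningful for balanced f only; see tens_liftP. *)
Definition tens_lift (W : zmodType) (f : A -> B -> W) (x : tens) : W :=
  formal_eval f (repr x).

Lemma tens_lift_pi (W : zmodType) (f : A -> B -> W) s : balanced f ->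
  tens_lift f (\pi_tens s) = formal_eval f s.
Proof.
move=> fP; have /eqmodP/asboolP : repr (\pi_tens s) = s %[mod tens] by rewrite reprK.
exact.
Qed.

Lemma tens_piP s t :
  (forall (W : zmodType) (f : A -> B -> W),
     balanced f -> formal_eval f s = formal_eval f t) ->
  \pi_tens s = \pi_tens t.
Proof. by move=> st; apply/eqmodP/asboolP. Qed.

Lemma formal_evalD (W : zmodType) (f : A -> B -> W) s t :
  formal_eval f (s ++ t) = formal_eval f s + formal_eval f t.
Proof. exact: big_cat. Qed.

Lemma balanced0l (W : zmodType) (f : A -> B -> W) : balanced f ->
  forall b, f 0 b = 0.
Proof.
by case=> fD _ _ b; apply: (addrI (f 0 b)); rewrite -fD !addr0.
Qed.

Lemma balancedNl (W : zmodType) (f : A -> B -> W) : balanced f ->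
  forall a b, f (- a) b = - f a b.
Proof.
move=> fP a b; apply: (addrI (f a b)); case: (fP) => fD _ _.
by rewrite -fD !subrr (balanced0l fP).
Qed.

Definition tens_zero : tens := \pi_tens [::].
Definition tens_add (x y : tens) : tens := \pi_tens (repr x ++ repr y).
Definition tens_opp (x : tens) : tens :=
  \pi_tens [seq (- p.1, p.2) | p <- repr x].
Definition tens_scale (c : K) (x : tens) : tens :=
  \pi_tens [seq (c *: p.1, p.2) | p <- repr x].

Definition pure a b : tens := \pi_tens [:: (a, b)].

Lemma tens_eqP (x y : tens) :
  (forall (W : zmodType) (f : A -> B -> W), balanced f ->
     tens_lift f x = tens_lift f y) -> x = y.
Proof. by move=> xy; rewrite -[x]reprK -[y]reprK; apply: tens_piP. Qed.

Lemma lift_zero (W : zmodType) (f : A -> B -> W) : balanced f ->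
  tens_lift f tens_zero = 0.
Proof. by move=> fP; rewrite tens_lift_pi // /formal_eval big_nil. Qed.

Lemma lift_add (W : zmodType) (f : A -> B -> W) x y : balanced f ->
  tens_lift f (tens_add x y) = tens_lift f x + tens_lift f y.
Proof. by move=> fP; rewrite tens_lift_pi // formal_evalD. Qed.

Lemma lift_opp (W : zmodType) (f : A -> B -> W) x : balanced f ->
  tens_lift f (tens_opp x) = - tens_lift f x.
Proof.
move=> fP; rewrite tens_lift_pi // /tens_lift /formal_eval big_map -sumrN.
by apply: eq_bigr => p _; rewrite /= balancedNl.
Qed.

Lemma balanced_scale (W : zmodType) (f : A -> B -> W) c : balanced f ->
  balanced (fun a b => f (c *: a) b).
Proof.
case=> fDl fDr fZ; split=> [a a' b|a b b'|c' a b].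
- by rewrite scalerDr fDl.
- by rewrite fDr.
by rewrite scalerA mulrC -scalerA fZ.
Qed.

Lemma lift_scale (W : zmodType) (f : A -> B -> W) c x : balanced f ->
  tens_lift f (tens_scale c x) = tens_lift (fun a b => f (c *: a) b) x.
Proof.
by move=> fP; rewrite tens_lift_pi // /tens_lift /formal_eval big_map.
Qed.

Lemma tens_addA : associative tens_add.
Proof.
by move=> x y z; apply: tens_eqP => W f fP; rewrite !lift_add // addrA.
Qed.

Lemma tens_addC : commutative tens_add.
Proof.
by move=> x y; apply: tens_eqP => W f fP; rewrite !lift_add // addrC.
Qed.

Lemma tens_add0 : left_id tens_zero tens_add.
Proof.
by move=> x; apply: tens_eqP => W f fP; rewrite lift_add // lift_zero // add0r.
Qed.

Lemma tens_addN : left_inverse tens_zero tens_opp tens_add.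
Proof.
move=> x; apply: tens_eqP => W f fP.
by rewrite lift_add // lift_opp // lift_zero // addNr.
Qed.

HB.instance Definition _ :=
  GRing.isZmodule.Build tens tens_addA tens_addC tens_add0 tens_addN.

Lemma tens_scaleA c d x : tens_scale c (tens_scale d x) = tens_scale (c * d) x.
Proof.
apply: tens_eqP => W f fP.
rewrite !lift_scale //; last exact: balanced_scale.
by congr tens_lift; apply/funext=> a; apply/funext=> b; rewrite scalerA mulrC.
Qed.

Lemma tens_scale1 : left_id 1 tens_scale.
Proof.
move=> x; apply: tens_eqP => W f fP; rewrite lift_scale //.
by congr tens_lift; apply/funext=> a; apply/funext=> b; rewrite scale1r.
Qed.

Lemma tens_scaleDr : right_distributive tens_scale +%R.
Proof.
move=> c x y; apply: tens_eqP => W f fP.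
by rewrite lift_scale // !lift_add // ?lift_scale //; apply: balanced_scale.
Qed.

Lemma tens_scaleDl v : {morph tens_scale^~ v : a b / a + b}.
Proof.
move=> c d /=; apply: tens_eqP => W f fP.
rewrite lift_add // !lift_scale // /tens_lift /formal_eval -big_split /=.
by apply: eq_bigr => p _; rewrite scalerDl; case: fP => ->.
Qed.

HB.instance Definition _ := GRing.Zmodule_isLmodule.Build K tens
  tens_scaleA tens_scale1 tens_scaleDr tens_scaleDl.

Lemma balanced_pure : balanced pure.
Proof.
split=> [a a' b|a b b'|c a b]; apply: tens_eqP => W f fP;
  rewrite ?lift_add // !tens_lift_pi // /formal_eval !big_seq1 /=;
  by case: fP.
Qed.

Lemma tens_lift_pure (W : zmodType) (f : A -> B -> W) a b : balanced f ->
  tens_lift f (pure a b) = f a b.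
Proof. by move=> fP; rewrite tens_lift_pi // /formal_eval big_seq1. Qed.

Lemma pureZl c a b : pure (c *: a) b = c *: pure a b.
Proof.
apply: tens_eqP => W f fP; rewrite tens_lift_pure // lift_scale //.
by rewrite tens_lift_pure //; apply: balanced_scale.
Qed.

Lemma tens_liftP (W : zmodType) (f : A -> B -> W) : balanced f ->
  (forall x y, tens_lift f (x + y) = tens_lift f x + tens_lift f y) /\
  (forall a b, tens_lift f (pure a b) = f a b).
Proof.
by move=> fP; split=> [x y|a b]; [rewrite lift_add | rewrite tens_lift_pure].
Qed.

Lemma tens_sum (x : tens) : exists s, x = \sum_(p <- s) pure p.1 p.2.
Proof.
exists (repr x); rewrite -{1}[x]reprK; elim: (repr x) => [|p s IHs].
  by rewrite big_nil.
rewrite big_cons -IHs; apply: tens_eqP => W f fP.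
rewrite lift_add // !tens_lift_pi // -formal_evalD.
by case: p.
Qed.

Lemma tens_ind (P : tens -> Prop) :
  P 0 -> (forall x y, P x -> P y -> P (x + y)) ->
  (forall a b, P (pure a b)) -> forall x, P x.
Proof.
move=> P0 PD Pp x; have [s ->] := tens_sum x.
by elim/big_rec: _ => // p y _; apply: PD.
Qed.

End Tensor.

(* Meaningful for additive f and g that are semilinear for a common ring
   morphism K -> K'; see tens_map_pure. *)
Definition tens_map (K K' : comPzRingType) (A B : lmodType K)
    (A' B' : lmodType K') (f : A -> A') (g : B -> B') : tens A B -> tens A' B' :=
  tens_lift (fun a b => pure (f a) (g b)).

Lemma balanced_map (K K' : comPzRingType) (s : K -> K') (A B : lmodType K)
    (A' B' : lmodType K') (f : A -> A') (g : B -> B') :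
  {morph f : x y / x + y} -> {morph g : x y / x + y} ->
  (forall c x, f (c *: x) = s c *: f x) ->
  (forall c x, g (c *: x) = s c *: g x) ->
  balanced (fun a b => pure (f a) (g b)).
Proof.
move=> fD gD fZ gZ; have [pDl pDr pZ] := balanced_pure A' B'.
by split=> *; rewrite ?fD ?gD ?fZ ?gZ.
Qed.

Section TensorAlgebra.
Variables (K : comPzRingType) (A B : comAlgType K).
Local Notation T := (tens A B).

Definition tens_mul (x y : T) : T :=
  tens_lift (fun a b => tens_lift (fun a' b' => pure (a * a') (b * b')) y) x.

Lemma balanced_mul a b :
  balanced (fun (a' : A) (b' : B) => pure (a * a') (b * b')).
Proof.
have [pDl pDr pZ] := balanced_pure A B.
by split=> *; rewrite ?mulrDr ?pDl ?pDr // -!scalerAr pZ.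
Qed.

Lemma balanced_mul2 (y : T) :
  balanced (fun a b => tens_lift (fun a' b' => pure (a * a') (b * b')) y).
Proof.
have [pDl pDr pZ] := balanced_pure A B.
split=> [a a' b|a b b'|c a b]; rewrite /tens_lift /formal_eval -?big_split;
  by apply: eq_bigr => p _; rewrite ?mulrDl ?pDl ?pDr // -!scalerAl pZ.
Qed.

Lemma tens_mul_pure a b a' b' :
  tens_mul (pure a b) (pure a' b') = pure (a * a') (b * b').
Proof.
rewrite /tens_mul tens_lift_pure; last exact: balanced_mul2.
by rewrite tens_lift_pure //; apply: balanced_mul.
Qed.

Lemma tens_mulDl : left_distributive tens_mul +%R.
Proof. by move=> x y z; apply: (lift_add _ _ (balanced_mul2 z)). Qed.

Lemma tens_mulDr : right_distributive tens_mul +%R.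
Proof.
move=> x y z; rewrite /tens_mul /tens_lift -big_split; apply: eq_bigr => p _.
exact: (lift_add _ _ (balanced_mul _ _)).
Qed.

Lemma tens_mul0l : left_zero 0 tens_mul.
Proof. by move=> y; apply: (lift_zero (balanced_mul2 y)). Qed.

Lemma tens_mul0r : right_zero 0 tens_mul.
Proof.
move=> y; rewrite /tens_mul /tens_lift /formal_eval big1 // => p _.
exact: (lift_zero (balanced_mul _ _)).
Qed.

Lemma tens_mulC : commutative tens_mul.
Proof.
move=> x y; elim/tens_ind: x => [|x x' IHx IHx'|a b].
- by rewrite tens_mul0l tens_mul0r.
- by rewrite tens_mulDl tens_mulDr IHx IHx'.
elim/tens_ind: y => [|y y' IHy IHy'|a' b'].
- by rewrite tens_mul0l tens_mul0r.
- by rewrite tens_mulDl tens_mulDr IHy IHy'.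
by rewrite !tens_mul_pure mulrC [b * _]mulrC.
Qed.

Lemma tens_mulA : associative tens_mul.
Proof.
move=> x y z; elim/tens_ind: x => [|x x' IHx IHx'|a b].
- by rewrite !tens_mul0l.
- by rewrite !tens_mulDl IHx IHx'.
elim/tens_ind: y => [|y y' IHy IHy'|a' b'].
- by rewrite !(tens_mul0l, tens_mul0r).
- by rewrite !(tens_mulDl, tens_mulDr) IHy IHy'.
elim/tens_ind: z => [|z z' IHz IHz'|a'' b''].
- by rewrite !tens_mul0r.
- by rewrite !tens_mulDr IHz IHz'.
by rewrite !tens_mul_pure !mulrA.
Qed.

Lemma tens_mul1 : left_id (pure 1 1) tens_mul.
Proof.
elim/tens_ind => [|x x' IHx IHx'|a b]; first exact: tens_mul0r.
  by rewrite tens_mulDr IHx IHx'.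
by rewrite tens_mul_pure !mul1r.
Qed.

HB.instance Definition _ := GRing.Zmodule_isComPzRing.Build T
  tens_mulA tens_mulC tens_mul1 tens_mulDl.

Lemma pureM a b a' b' : pure a b * pure a' b' = pure (a * a') (b * b') :> T.
Proof. exact: tens_mul_pure. Qed.

Definition tens_inl (a : A) : T := pure a 1.
Definition tens_inr (b : B) : T := pure 1 b.

Lemma tens_inl_zmod : zmod_morphism tens_inl.
Proof.
have fP := balanced_pure A B; case: (fP) => pDl _ _.
by move=> x y; rewrite /tens_inl pDl (balancedNl fP).
Qed.

Lemma tens_inl_monoid : monoid_morphism tens_inl.
Proof. by split=> // x y; rewrite /tens_inl pureM mulr1. Qed.

Lemma tens_inr_zmod : zmod_morphism tens_inr.
Proof.
move=> x y; apply/eqP; rewrite eq_sym subr_eq; apply/eqP.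
by rewrite /tens_inr; have [_ <- _] := balanced_pure A B; rewrite subrK.
Qed.

Lemma tens_inr_monoid : monoid_morphism tens_inr.
Proof. by split=> // x y; rewrite /tens_inr pureM mulr1. Qed.

HB.instance Definition _ := GRing.isZmodMorphism.Build A T tens_inl tens_inl_zmod.
HB.instance Definition _ :=
  GRing.isMonoidMorphism.Build A T tens_inl tens_inl_monoid.
HB.instance Definition _ := GRing.isZmodMorphism.Build B T tens_inr tens_inr_zmod.
HB.instance Definition _ :=
  GRing.isMonoidMorphism.Build B T tens_inr tens_inr_monoid.

End TensorAlgebra.

(* Restriction of scalars along a ring morphism. *)
Definition restr (K K' : pzRingType) (f : {rmorphism K -> K'})
  (W : lmodType K') : Type := W.

Section Restriction.
Variables (K K' : pzRingType) (f : {rmorphism K -> K'}) (W : lmodType K').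
HB.instance Definition _ := GRing.Zmodule.copy (restr f W) W.

Definition restr_scale (c : K) (w : restr f W) : restr f W := f c *: (w : W).

Lemma restr_scaleA c d w :
  restr_scale c (restr_scale d w) = restr_scale (c * d) w.
Proof. by rewrite /restr_scale scalerA -rmorphM. Qed.

Lemma restr_scale1 : left_id 1 restr_scale.
Proof. by move=> w; rewrite /restr_scale rmorph1 scale1r. Qed.

Lemma restr_scaleDr : right_distributive restr_scale +%R.
Proof. by move=> c v w; apply: scalerDr. Qed.

Lemma restr_scaleDl w : {morph restr_scale^~ w : c d / c + d}.
Proof. by move=> c d; rewrite /restr_scale rmorphD scalerDl. Qed.

HB.instance Definition _ := GRing.Zmodule_isLmodule.Build K (restr f W)
  restr_scaleA restr_scale1 restr_scaleDr restr_scaleDl.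
End Restriction.

Section RestrictionAlgebra.
Variables (K K' : pzRingType) (f : {rmorphism K -> K'}) (A : comAlgType K').
HB.instance Definition _ := GRing.ComNzRing.copy (restr f A) A.

Lemma restr_scaleAl (c : K) (x y : restr f A) : c *: (x * y) = (c *: x) * y.
Proof. exact: (@scalerAl K' A). Qed.

HB.instance Definition _ :=
  GRing.Lmodule_isLalgebra.Build K (restr f A) restr_scaleAl.
HB.instance Definition _ := GRing.Lalgebra_isComAlgebra.Build K (restr f A).
End RestrictionAlgebra.

(* Evaluation of a polynomial through a map of coefficients: mpoly.mmap, but
   for a target ring that is not required to be nonzero. *)
Definition mpoly_eval (n : nat) (A : nzRingType) (S : comPzRingType)
    (f : A -> S) (x : 'I_n -> S) (h : {mpoly A[n]}) : S :=
  \sum_(m <- msupp h) f h@_m * \prod_(i < n) x i ^+ m i.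

Section EvalMorphism.
Variables (n : nat) (A : comNzRingType) (S : comPzRingType).
Variables (f : {rmorphism A -> S}) (x : 'I_n -> S).

Lemma mpoly_eval_zmod : zmod_morphism (mpoly_eval f x).
Proof.
have [S0|S1] := eqVneq (1 : S) 0.
  by move=> p q; rewrite -[LHS]mulr1 -[RHS]mulr1 S0 !mulr0.
pose S' : comNzRingType :=
  HB.pack (GRing.ComPzRing.sort S) (GRing.PzSemiRing_isNonZero.Build S S1).
pose f' : A -> S' := f.
pose g : {rmorphism A -> S'} := HB.pack f'
  (GRing.isZmodMorphism.Build A S' f' (rmorphB f))
  (GRing.isMonoidMorphism.Build A S' f' (rmorphism_monoidP f)).
exact: (@mmap_is_additive n A S' x g).
Qed.

Lemma mpoly_eval_monoid : monoid_morphism (mpoly_eval f x).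
Proof.
have [S0|S1] := eqVneq (1 : S) 0.
  have S_sub (u v : S) : u = v by rewrite -[u]mulr1 -[v]mulr1 S0 !mulr0.
  by split=> [|p q]; apply: S_sub.
pose S' : comNzRingType :=
  HB.pack (GRing.ComPzRing.sort S) (GRing.PzSemiRing_isNonZero.Build S S1).
pose f' : A -> S' := f.
pose g : {rmorphism A -> S'} := HB.pack f'
  (GRing.isZmodMorphism.Build A S' f' (rmorphB f))
  (GRing.isMonoidMorphism.Build A S' f' (rmorphism_monoidP f)).
by have [? ?] := @mmap_is_multiplicative n A S' x g; split.
Qed.
End EvalMorphism.

Section TensMapTheory.
Variables (K K' : comPzRingType) (s : K -> K').
Variables (A B : lmodType K) (A' B' : lmodType K') (f : A -> A') (g : B -> B').
Hypotheses (fD : {morph f : x y / x + y}) (gD : {morph g : x y / x + y}).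
Hypotheses (fZ : forall c x, f (c *: x) = s c *: f x).
Hypotheses (gZ : forall c x, g (c *: x) = s c *: g x).

Lemma tens_map_pure a b : tens_map f g (pure a b) = pure (f a) (g b).
Proof. exact: tens_lift_pure (balanced_map fD gD fZ gZ). Qed.

Lemma tens_mapD : {morph tens_map f g : x y / x + y}.
Proof. by move=> x y; apply: (lift_add _ _ (balanced_map fD gD fZ gZ)). Qed.

Lemma tens_map0 : tens_map f g 0 = 0.
Proof. exact: (lift_zero (balanced_map fD gD fZ gZ)). Qed.

Lemma tens_mapZ c x : tens_map f g (c *: x) = s c *: tens_map f g x.
Proof.
elim/tens_ind: x => [|x y IHx IHy|a b].
- by rewrite scaler0 tens_map0 scaler0.
- by rewrite scalerDr !tens_mapD scalerDr IHx IHy.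
by rewrite -pureZl !tens_map_pure fZ pureZl.
Qed.
End TensMapTheory.

(* Separability in the sense of not necessarily finite algebras: A remains
   reduced after every extension of the base field. *)
Definition separable_alg (K : fieldType) (A : comAlgType K) : Prop :=
  forall K' : comAlgType K, (forall x : K', x != 0 -> exists y, x * y = 1) ->
  forall (x : tens A K') (n : nat), x ^+ n = 0 -> x = 0.

(* The inclusion of F into E is the morphism st_inc, that of E into L is the
   structure morphism of the algebra st_L, and L = prod_l L_l is given by the
   projections st_pr l : L -> L_l, so that L_l, as a subset of L, consists of
   the x with st_pr k x = 0 for all k != l. *)
Record sigma_triple := SigmaTriple {
  st_d : nat;
  st_F : fieldType;
  st_E : fieldType;
  st_L : comUnitAlgType st_E;
  st_comp : 'I_st_d -> fieldType;
  st_inc : {rmorphism st_F -> st_E};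
  st_pr : forall l, {rmorphism st_L -> st_comp l};
  st_sigE : {rmorphism st_E -> st_E};
  st_sigL : {rmorphism st_L -> st_L};
  st_d_gt0 : (0 < st_d)%N;
  st_prP : forall x : (forall l, st_comp l),
    exists! y : st_L, forall l, st_pr l y = x l;
  st_sigLE : forall e, st_sigL e%:A = (st_sigE e)%:A;
  st_sig_comp : forall l (x : st_L), (forall k, k != l -> st_pr k x = 0) ->
    forall k, k != ordS l -> st_pr k (st_sigL x) = 0;
  st_fixE : forall e, st_sigE e = e <-> exists a, e = st_inc a;
  st_fixL : forall x : st_L, st_sigL x = x <-> exists a, x = (st_inc a)%:A;
  st_sep : separable_alg st_L
}.

Record phi_mod (K : fieldType) (sigma : {rmorphism K -> K}) := PhiMod {
  pm_car :> lmodType K;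
  pm_phi : pm_car -> pm_car;
  pm_phiD : {morph pm_phi : x y / x + y};
  pm_phiZ : forall a x, pm_phi (a *: x) = sigma a *: pm_phi x
}.

Record phi_hom (K : fieldType) (sigma : {rmorphism K -> K})
    (N P : phi_mod sigma) := PhiHom {
  ph_fun :> {linear N -> P};
  ph_comm : forall x, ph_fun (pm_phi x) = pm_phi (ph_fun x)
}.

Section PhiModOps.
Variables (K : fieldType) (sigma : {rmorphism K -> K}).
Implicit Types N P : phi_mod sigma.

Definition is_basis (W : lmodType K) (n : nat) (b : 'I_n -> W) : Prop :=
  forall x : W, exists! c : 'rV[K]_n, x = \sum_(i < n) c 0 i *: b i.

Definition fin_dim (W : lmodType K) : Prop :=
  exists n, exists b : 'I_n -> W, is_basis b.

Definition phi_unit : phi_mod sigma :=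
  @PhiMod K sigma K^o sigma (rmorphD sigma) (rmorphM sigma).

Lemma phi_sumD N P :
  {morph (fun x : N * P => (pm_phi x.1, pm_phi x.2)) : x y / x + y}.
Proof. by move=> x y /=; rewrite !pm_phiD. Qed.

Lemma phi_sumZ N P a (x : N * P) :
  (pm_phi (a *: x).1, pm_phi (a *: x).2) =
  sigma a *: (pm_phi x.1, pm_phi x.2) :> N * P.
Proof. by rewrite !pm_phiZ. Qed.

Definition phi_sum N P : phi_mod sigma :=
  PhiMod (@phi_sumD N P) (@phi_sumZ N P).

Definition phi_tens N P : phi_mod sigma :=
  PhiMod
    (tens_mapD (@pm_phiD _ _ N) (@pm_phiD _ _ P) (@pm_phiZ _ _ N) (@pm_phiZ _ _ P))
    (tens_mapZ (@pm_phiD _ _ N) (@pm_phiD _ _ P) (@pm_phiZ _ _ N) (@pm_phiZ _ _ P)).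

(* P is (isomorphic to) the dual Hom_K(N, K) of N, with phi determined by
   (phi f)(phi x) = sigma (f x). *)
Definition is_dual P N : Prop :=
  exists b : P -> {linear N -> K^o},
    [/\ forall p p' n, b (p + p') n = b p n + b p' n,
        forall a p n, b (a *: p) n = a * b p n,
        forall f : {linear N -> K^o}, exists! p, b p =1 f
      & forall p n, b (pm_phi p) (pm_phi n) = sigma (b p n)].

End PhiModOps.

Section Solutions.
Variable T : sigma_triple.
Local Notation F := (st_F T).
Local Notation E := (st_E T).
Local Notation L := (st_L T).
Local Notation sigE := (st_sigE T).
Local Notation sigL := (st_sigL T).
Local Notation inc := (st_inc T).
Local Notation LF := (restr inc L).
Local Notation phimod := (phi_mod sigE).
Implicit Types N P Q : phimod.

Definition phiL N : tens L N -> tens L N := tens_map sigL (@pm_phi _ _ N).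

Lemma sigLZ (c : E) (x : L) : sigL (c *: x) = sigE c *: sigL x.
Proof. by rewrite -mulr_algl rmorphM st_sigLE mulr_algl. Qed.

Lemma phiLD N : {morph @phiL N : x y / x + y}.
Proof. exact: (tens_mapD (rmorphD sigL) (@pm_phiD _ _ N) sigLZ (@pm_phiZ _ _ N)). Qed.

Lemma phiLZ N c (x : tens L N) : phiL (c *: x) = sigE c *: phiL x.
Proof. exact: (tens_mapZ (rmorphD sigL) (@pm_phiD _ _ N) sigLZ (@pm_phiZ _ _ N)). Qed.

Lemma phiL_pure N l (n : N) : phiL (pure l n) = pure (sigL l) (pm_phi n).
Proof.
exact: (tens_map_pure (rmorphD sigL) (@pm_phiD _ _ N) sigLZ (@pm_phiZ _ _ N)).
Qed.

Lemma sigE_inc a : sigE (inc a) = inc a.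
Proof. by apply/st_fixE; exists a. Qed.

(* V(N) *)
Definition is_sol N : {pred restr inc (tens L N)} :=
  fun x => `[< @phiL N x = x >].

Lemma is_sol_closed N : submod_closed (@is_sol N).
Proof.
split=> [|c x y /asboolP xV /asboolP yV]; apply/asboolP.
  by apply: (addrI (@phiL N 0)); rewrite -phiLD !addr0.
by rewrite phiLD phiLZ sigE_inc xV yV.
Qed.

HB.instance Definition _ N := GRing.isSubmodClosed.Build F
  (restr inc (tens L N)) (@is_sol N) (is_sol_closed N).

Record sol N := Sol { sol_val : restr inc (tens L N); _ : sol_val \in @is_sol N }.
HB.instance Definition _ N := [isSub for @sol_val N].
HB.instance Definition _ N := [Choice of sol N by <:].
HB.instance Definition _ N := [SubChoice_isSubLmodule of sol N by <:].

End Solutions.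

Section Functors.
Variable T : sigma_triple.
Local Notation F := (st_F T).
Local Notation E := (st_E T).
Local Notation L := (st_L T).
Local Notation sigE := (st_sigE T).
Local Notation sigL := (st_sigL T).
Local Notation inc := (st_inc T).
Local Notation LF := (restr inc L).
Local Notation phimod := (phi_mod sigE).
Implicit Types N P Q : phimod.

Lemma sol_valP N (v : sol N) : @phiL T N (sol_val v) = sol_val v.
Proof. by case: v => v /= /asboolP. Qed.

Definition sol_cmp N : tens LF (sol N) -> tens L N :=
  tens_lift (fun (a : LF) (v : sol N) =>
    tens_map (fun b : L => (a : L) * b) id (sol_val v : tens L N)).

Definition L_trivial N : Prop := fin_dim N /\ bijective (@sol_cmp N).

Definition tens_hom N P (f : phi_hom N P) : tens L N -> tens L P :=
  tens_map id f.

Lemma phiL_hom N P (f : phi_hom N P) (x : tens L N) :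
  @phiL T P (tens_hom f x) = tens_hom f (@phiL T N x).
Proof.
have idD : {morph @id L : x y / x + y} by [].
have idZ (c : E) (l : L) : c *: l = c *: l by [].
have hD := tens_mapD idD (raddfD f) idZ (linearZZ f).
have h0 := tens_map0 idD (raddfD f) idZ (linearZZ f).
have hp := tens_map_pure idD (raddfD f) idZ (linearZZ f).
have p0 Q : @phiL T Q 0 = 0 by apply: (addrI (@phiL T Q 0)); rewrite -phiLD !addr0.
elim/tens_ind: x => [|x y IHx IHy|l n].
- by rewrite /tens_hom h0 !p0 h0.
- by rewrite /tens_hom hD !phiLD hD -/(tens_hom f) IHx IHy.
by rewrite /tens_hom hp !phiL_pure hp /= ph_comm.
Qed.

Lemma sol_map_subproof N P (f : phi_hom N P) (v : sol N) :
  tens_hom f (sol_val v) \in @is_sol T P.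
Proof. by apply/asboolP; rewrite phiL_hom sol_valP. Qed.

(* V(f) *)
Definition sol_map N P (f : phi_hom N P) (v : sol N) : sol P :=
  Sol (sol_map_subproof f v).

(* (l (x) n, l' (x) n') |-> l l' (x) (n (x) n') *)
Definition tens_box N P (x : tens L N) (y : tens L P) :
    tens L (phi_tens N P) :=
  tens_lift (fun (l : L) (n : N) => tens_lift (fun (l' : L) (n' : P) =>
    pure (l * l') (pure n n' : phi_tens N P)) y) x.

Lemma balanced_box N P (l : L) (n : N) :
  balanced (fun (l' : L) (n' : P) => pure (l * l') (pure n n' : phi_tens N P)).
Proof.
have [pDl pDr pZ] := balanced_pure L (phi_tens N P).
have [qDl qDr qZ] := balanced_pure N P.
split=> [a a' b|a b b'|c a b]; first by rewrite mulrDr pDl.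
  by rewrite qDr pDr.
by rewrite -scalerAr pZ -pureZl qZ.
Qed.

Lemma balanced_box2 N P (y : tens L P) :
  balanced (fun (l : L) (n : N) => tens_lift (fun (l' : L) (n' : P) =>
    pure (l * l') (pure n n' : phi_tens N P)) y).
Proof.
have [pDl pDr pZ] := balanced_pure L (phi_tens N P).
have [qDl qDr qZ] := balanced_pure N P.
split=> [a a' b|a b b'|c a b]; rewrite /tens_lift /formal_eval -?big_split;
  apply: eq_bigr => p _; first by rewrite mulrDl pDl.
  by rewrite qDl pDr.
by rewrite -scalerAl pZ -pureZl.
Qed.

Lemma tens_box_pure N P l (n : N) l' (n' : P) :
  tens_box (pure l n) (pure l' n') =
  pure (l * l') (pure n n' : phi_tens N P).
Proof.
rewrite /tens_box tens_lift_pure; last exact: balanced_box2.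
by rewrite tens_lift_pure //; apply: balanced_box.
Qed.

Lemma tens_boxDl N P (x x' : tens L N) (y : tens L P) :
  tens_box (x + x') y = tens_box x y + tens_box x' y.
Proof. exact: (@lift_add _ _ _ _ _ x x' (@balanced_box2 N P y)). Qed.

Lemma tens_boxDr N P (x : tens L N) (y y' : tens L P) :
  tens_box x (y + y') = tens_box x y + tens_box x y'.
Proof.
rewrite /tens_box {1 3 5}/tens_lift -big_split; apply: eq_bigr => p _.
exact: (@lift_add _ _ _ _ _ y y' (@balanced_box N P p.1 p.2)).
Qed.

Lemma tens_box0l N P (y : tens L P) : tens_box (0 : tens L N) y = 0.
Proof. by apply: (addrI (tens_box 0 y)); rewrite -tens_boxDl !addr0. Qed.

Lemma tens_box0r N P (x : tens L N) : tens_box x (0 : tens L P) = 0.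
Proof. by apply: (addrI (tens_box x 0)); rewrite -tens_boxDr !addr0. Qed.

Lemma phiL_box N P (x : tens L N) (y : tens L P) :
  @phiL T (phi_tens N P) (tens_box x y) =
  tens_box (@phiL T N x) (@phiL T P y).
Proof.
have p0 Q : @phiL T Q 0 = 0 by apply: (addrI (@phiL T Q 0)); rewrite -phiLD !addr0.
elim/tens_ind: x => [|x x' IHx IHx'|l n].
- by rewrite p0 !tens_box0l p0.
- by rewrite tens_boxDl !phiLD tens_boxDl IHx IHx'.
elim/tens_ind: y => [|y y' IHy IHy'|l' n'].
- by rewrite p0 !tens_box0r p0.
- by rewrite tens_boxDr !phiLD tens_boxDr IHy IHy'.
rewrite tens_box_pure !phiL_pure tens_box_pure rmorphM; congr pure.
exact: (tens_map_pure (@pm_phiD _ _ N) (@pm_phiD _ _ P)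
  (@pm_phiZ _ _ N) (@pm_phiZ _ _ P)).
Qed.

Lemma sol_box_subproof N P (v : sol N) (w : sol P) :
  tens_box (sol_val v) (sol_val w) \in @is_sol T (phi_tens N P).
Proof. by apply/asboolP; rewrite phiL_box !sol_valP. Qed.

Definition sol_box N P (v : sol N) (w : sol P) : sol (phi_tens N P) :=
  Sol (sol_box_subproof v w).

(* T_M: the smallest class of L-trivial modules that contains M and the unit
   object and is closed under direct sums, tensor products, duals, subobjects
   and quotients (hence under isomorphisms). *)
Inductive tannakian_gen (M : phimod) : phimod -> Prop :=
| tg_gen : tannakian_gen M M
| tg_unit : tannakian_gen M (phi_unit sigE)
| tg_sum N P : tannakian_gen M N -> tannakian_gen M P ->
    tannakian_gen M (phi_sum N P)
| tg_tens N P : tannakian_gen M N -> tannakian_gen M P ->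
    tannakian_gen M (phi_tens N P)
| tg_dual N P : tannakian_gen M N -> is_dual P N -> tannakian_gen M P
| tg_sub N P (f : phi_hom P N) : tannakian_gen M N -> L_trivial P ->
    injective f -> tannakian_gen M P
| tg_quot N P (f : phi_hom N P) : tannakian_gen M N -> L_trivial P ->
    (forall y, exists x, f x = y) -> tannakian_gen M P.

Section TensorAutomorphisms.
Variable R : comAlgType F.

Definition base_scale (W : lmodType F) (r : R) : tens R W -> tens R W :=
  tens_map (fun s : R => r * s) id.

(* (R (x) V(N)) x (R (x) V(P)) -> R (x) V(N (x) P) *)
Definition base_box N P (x : tens R (sol N)) (y : tens R (sol P)) :
    tens R (sol (phi_tens N P)) :=
  tens_lift (fun (r : R) (v : sol N) => tens_lift (fun (s : R) (w : sol P) =>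
    pure (r * s) (sol_box v w)) y) x.

(* Only the values of lam on the objects of T_M matter. *)
Definition tens_aut (M : phimod)
    (lam : forall N, tens R (sol N) -> tens R (sol N)) : Prop :=
  [/\ forall N, tannakian_gen M N ->
        [/\ forall x y, lam N (x + y) = lam N x + lam N y,
            forall r x, lam N (base_scale r x) = base_scale r (lam N x)
          & bijective (lam N)],
      forall N P (f : phi_hom N P), tannakian_gen M N -> tannakian_gen M P ->
        forall x, lam P (tens_map id (sol_map f) x) =
                  tens_map id (sol_map f) (lam N x),
      forall x, lam (phi_unit sigE) x = x
    & forall N P, tannakian_gen M N -> tannakian_gen M P ->
        forall x y, lam (phi_tens N P) (base_box x y) =
                    base_box (lam N x) (lam P y)].
End TensorAutomorphisms.

(* An F-algebra B with a universal tensor automorphism, i.e. an affine scheme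
   Spec B representing the functor R |-> Aut^(x)(R (x) V on T_M).  The image of
   tg_univ under f : B -> R is determined, by R-linearity, by its values on the
   1 (x) v. *)
Definition base_change (B R : comAlgType F) (f : B -> R) (W : lmodType F) :
  tens B W -> tens R W := tens_map f id.

Record tannaka_group (M : phimod) := TannakaGroup {
  tg_alg : comAlgType F;
  tg_univ : forall N, tens tg_alg (sol N) -> tens tg_alg (sol N);
  tg_univ_aut : tens_aut M tg_univ;
  tg_univP : forall (R : comAlgType F)
      (lam : forall N, tens R (sol N) -> tens R (sol N)), tens_aut M lam ->
    exists f : {lrmorphism tg_alg -> R},
      (forall N, tannakian_gen M N -> forall v : sol N,
         lam N (pure 1 v) = base_change f (tg_univ (pure 1 v))) /\
      (forall g : {lrmorphism tg_alg -> R},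
        (forall N, tannakian_gen M N -> forall v : sol N,
           lam N (pure 1 v) = base_change g (tg_univ (pure 1 v))) -> f =1 g)
}.

End Functors.

Arguments tg_univ {T M} t {N}.

(* F[X, 1/det X] for X an r x r matrix of indeterminates is presented as the
   quotient of the polynomial ring in the r^2 + 1 variables X_ij, Y by
   Y det X - 1; gl_point X Y lists the values given to these variables. *)
Notation gl_poly K r := {mpoly K[r * r + 1]}.

Definition gl_point (S : Type) (r : nat) (g : 'M[S]_r) (y : S)
    (k : 'I_(r * r + 1)) : S :=
  row_mx (mxvec g) (const_mx y : 'rV_1) 0 k.

Definition gl_eval (K : nzRingType) (S : comPzRingType) (r : nat) (f : K -> S)
    (g : 'M[S]_r) (y : S) (h : gl_poly K r) : S :=
  mpoly_eval f (gl_point g y) h.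

Section Gamma.
Variable T : sigma_triple.
Local Notation F := (st_F T).
Local Notation E := (st_E T).
Local Notation L := (st_L T).
Local Notation sigE := (st_sigE T).
Local Notation inc := (st_inc T).
Local Notation LF := (restr inc L).
Local Notation phimod := (phi_mod sigE).
Local Notation LL := (tens L L).
Variables (r : nat) (Psi : 'M[L]_r).

Definition base_LL : F -> LL := @tens_inl E L L \o in_alg L \o inc.

HB.instance Definition _ := GRing.RMorphism.on base_LL.

(* (Psi (x) 1)^-1 (1 (x) Psi), and the inverse of its determinant *)
Definition Z_mx : 'M[LL]_r :=
  map_mx (@tens_inl E L L) (invmx Psi) *m map_mx (@tens_inr E L L) Psi.
Definition Z_invdet : LL :=
  tens_inl L (\det Psi) * tens_inr L (\det (invmx Psi)).

(* Contains Y det X - 1, as Psi is invertible, so that the quotient below is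
   also that of F[X, 1/det X] by the kernel of X |-> Z. *)
Definition gamma_ker : {pred gl_poly F r} :=
  fun h => `[< gl_eval base_LL Z_mx Z_invdet h = 0 >].

Lemma LL_neq0 : (1 : LL) != 0.
Proof.
have mP : balanced (fun a b : L => a * b).
  by split=> [a a' b|a b b'|c a b];
    rewrite ?mulrDl ?mulrDr // -scalerAl -scalerAr.
apply/eqP => /(congr1 (tens_lift (fun a b : L => a * b))).
rewrite (lift_zero mP) tens_lift_pure // mulr1 => /eqP.
by rewrite oner_eq0.
Qed.

Lemma gamma_ker_zmod : zmod_closed gamma_ker.
Proof.
have evB : zmod_morphism (gl_eval base_LL Z_mx Z_invdet) :=
  mpoly_eval_zmod base_LL _.
split=> [|p q /asboolP p0 /asboolP q0]; apply/asboolP.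
  by rewrite -(subrr 0) evB subrr.
by rewrite evB p0 q0 subrr.
Qed.

Lemma gamma_ker_ideal :
  1 \notin gamma_ker /\ forall a, {in gamma_ker, forall u, a * u \in gamma_ker}.
Proof.
have [ev1 evM] : monoid_morphism (gl_eval base_LL Z_mx Z_invdet) :=
  mpoly_eval_monoid base_LL _.
split; first by apply/asboolP; rewrite ev1; apply/eqP/LL_neq0.
by move=> p q /asboolP q0; apply/asboolP; rewrite evM q0 mulr0.
Qed.

HB.instance Definition _ :=
  GRing.isZmodClosed.Build (gl_poly F r) gamma_ker gamma_ker_zmod.
HB.instance Definition _ :=
  isProperIdeal.Build (gl_poly F r) gamma_ker gamma_ker_ideal.

(* F[Gamma], so that Gamma(R) is {lrmorphism gamma_alg -> R} *)
Definition gamma_alg : Type := {ideal_quot gamma_ker}.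
HB.instance Definition _ := GRing.ComNzRing.on gamma_alg.

Definition gamma_proj (h : gl_poly F r) : gamma_alg :=
  \pi_{ideal_quot gamma_ker} h.

Lemma gamma_proj_zmod : zmod_morphism gamma_proj.
Proof. exact: (rmorphB (\pi_{ideal_quot gamma_ker})). Qed.

Lemma gamma_proj_monoid : monoid_morphism gamma_proj.
Proof. exact: (rmorphism_monoidP (\pi_{ideal_quot gamma_ker})). Qed.

HB.instance Definition _ := GRing.isZmodMorphism.Build
  (gl_poly F r) gamma_alg gamma_proj gamma_proj_zmod.
HB.instance Definition _ := GRing.isMonoidMorphism.Build
  (gl_poly F r) gamma_alg gamma_proj gamma_proj_monoid.

Definition gamma_scale (a : F) (x : gamma_alg) : gamma_alg :=
  gamma_proj a%:MP * x.

Lemma gamma_scaleA a b x :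
  gamma_scale a (gamma_scale b x) = gamma_scale (a * b) x.
Proof. by rewrite /gamma_scale mpolyCM rmorphM mulrA. Qed.

Lemma gamma_scale1 : left_id 1 gamma_scale.
Proof. by move=> x; rewrite /gamma_scale rmorph1 mul1r. Qed.

Lemma gamma_scaleDr : right_distributive gamma_scale +%R.
Proof. by move=> a x y; apply: mulrDr. Qed.

Lemma gamma_scaleDl x : {morph gamma_scale^~ x : a b / a + b}.
Proof. by move=> a b; rewrite /gamma_scale mpolyCD rmorphD mulrDl. Qed.

HB.instance Definition _ := GRing.Zmodule_isLmodule.Build F gamma_alg
  gamma_scaleA gamma_scale1 gamma_scaleDr gamma_scaleDl.

Lemma gamma_scaleAl (a : F) (x y : gamma_alg) : a *: (x * y) = (a *: x) * y.
Proof. exact: mulrA. Qed.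

HB.instance Definition _ :=
  GRing.Lmodule_isLalgebra.Build F gamma_alg gamma_scaleAl.
HB.instance Definition _ := GRing.Lalgebra_isComAlgebra.Build F gamma_alg.

Section Action.
Variables (R : comAlgType F) (gam : {lrmorphism gamma_alg -> R}).
Local Notation RL := (tens R LF).

(* The point of GL_r(R) given by gam in Gamma(R), and the inverse of its
   determinant. *)
Definition gamma_mx : 'M[R]_r :=
  \matrix_(i, j) gam (gamma_proj 'X_(lshift 1 (mxvec_index i j))).
Definition gamma_invdet : R := gam (gamma_proj 'X_(rshift (r * r) ord0)).

Definition base_RL (e : E) : RL := @tens_inr F R LF (e%:A : L).

Lemma base_RL_zmod : zmod_morphism base_RL.
Proof. by move=> x y; rewrite /base_RL scalerBl; apply: rmorphB. Qed.

Lemma base_RL_monoid : monoid_morphism base_RL.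
Proof.
split=> [|x y]; rewrite /base_RL; first by rewrite scale1r.
have -> : (x * y)%:A = x%:A * y%:A :> L by apply: (rmorphM (in_alg L)).
exact: (rmorphM (@tens_inr F R LF)).
Qed.

HB.instance Definition _ := GRing.isZmodMorphism.Build E RL base_RL base_RL_zmod.
HB.instance Definition _ :=
  GRing.isMonoidMorphism.Build E RL base_RL base_RL_monoid.

(* R (x)_F L as an E-module *)
Definition RL_mod : lmodType E := restr base_RL RL^o.

(* R (x)_F V(N) -> (R (x)_F L) (x)_E N *)
Definition sol_incl (N : phimod) : tens R (sol N) -> tens RL_mod N :=
  tens_lift (fun (a : R) (v : sol N) =>
    tens_map (fun l : L => pure a (l : LF) : RL_mod) id (sol_val v : tens L N)).

(* h(Psi) in L and h(Psi gam) in R (x)_F L, for h in E[X, 1/det X] *)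
Definition eval_Psi : gl_poly E r -> L :=
  gl_eval (in_alg L) Psi (\det (invmx Psi)).
Definition eval_Psi_gam : gl_poly E r -> RL :=
  gl_eval base_RL
    (map_mx (@tens_inr F R LF) (Psi : 'M[LF]_r) *m map_mx (@tens_inl F R LF) gamma_mx)
    (@tens_inr F R LF (\det (invmx Psi)) * @tens_inl F R LF gamma_invdet).

(* mu : V(N) -> R (x)_F V(N) is the restriction to V(N) of the automorphism
   h(Psi) (x) n |-> h(Psi gam) (x) n of (R (x)_F Sigma) (x)_E N.  Here Sigma is
   the image of eval_Psi, Sigma (x)_E N is seen inside L (x)_E N and
   (R (x)_F Sigma) (x)_E N inside (R (x)_F L) (x)_E N. *)
Definition restricts_translation (N : phimod)
    (mu : sol N -> tens R (sol N)) : Prop :=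
  forall (v : sol N) (s : seq (gl_poly E r * N)),
    (sol_val v : tens L N) = \sum_(p <- s) pure (eval_Psi p.1) p.2 ->
    sol_incl (mu v) = \sum_(p <- s) pure (eval_Psi_gam p.1 : RL_mod) p.2.

End Action.

(* pi : Spec F[Gamma] -> Spec B = Gamma_M, given by its comorphism: it sends
   gam in Gamma(R) to the tensor automorphism by which gam acts. *)
Definition is_pi (M : phimod) (G : tannaka_group M)
    (pi : {lrmorphism tg_alg G -> gamma_alg}) : Prop :=
  forall (R : comAlgType F) (gam : {lrmorphism gamma_alg -> R}) (N : phimod),
    tannakian_gen M N ->
    restricts_translation gam
      (fun v : sol N => base_change (gam \o pi) (tg_univ G (pure 1 v))).

End Gamma.

(* The morphism Spec B -> Spec A with comorphism f : A -> B *)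
Definition closed_immersion (A B : Type) (f : A -> B) : Prop :=
  forall b, exists a, f a = b.

(* Main.v *)
From HB Require Import structures.
Require Import Defs.
From mathcomp Require Import mpoly.
From mathcomp Require Import all_boot all_order all_algebra.
From mathcomp Require Import boolp.
Set Implicit Arguments.
Unset Strict Implicit.
Import GRing.Theory.
Local Open Scope ring_scope.

(* The solutions v = Psi^-1 m form an F-basis of V(M), and gam in Gamma(R) acts
   on it by v |-> gam^-1 v.  For the universal point gam = id, the action is the
   image under pi of that of the universal tensor automorphism of M, so that the
   entries of X^-1 in F[Gamma] are images under pi.  As the universal tensor
   automorphism is invertible over F[Gamma_M], so are the entries of X, and then
   1 / det X = det(X^-1).  Hence pi hits all generators of F[Gamma]. *)

(** * Evaluation of F[X, 1/det X] at matrix points *)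

Section PolynomialEvaluation.
Variables (n : nat) (A : nzRingType) (S : comPzRingType).
Variables (f : {rmorphism A -> S}) (x : 'I_n -> S).

Lemma mpoly_evalX i : mpoly_eval f x 'X_i = x i.
Proof.
rewrite /mpoly_eval msuppX big_seq1 mcoeffX eqxx rmorph1 mul1r.
rewrite (bigD1 i) //= mnm1E eqxx expr1 big1 ?mulr1 // => j /negPf ji.
by rewrite mnm1E eq_sym ji expr0.
Qed.

Lemma mpoly_evalC c : mpoly_eval f x c%:MP = f c.
Proof.
rewrite /mpoly_eval msuppC; case: eqVneq => [->|_].
  by rewrite big_nil rmorph0.
rewrite big_seq1 mcoeffC eqxx mulr1 big1 ?mulr1 // => i _.
by rewrite mnm0E expr0.
Qed.

End PolynomialEvaluation.

Section GlPoint.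
Variables (S : Type) (r : nat) (g : 'M[S]_r) (y : S).

Lemma gl_point_entry i j : gl_point g y (lshift 1 (mxvec_index i j)) = g i j.
Proof. by rewrite /gl_point row_mxEl mxvecE. Qed.

Lemma gl_point_inv : gl_point g y (rshift (r * r) ord0) = y.
Proof. by rewrite /gl_point row_mxEr mxE. Qed.

End GlPoint.

Definition gl_X (K : nzRingType) r : 'M[gl_poly K r]_r :=
  \matrix_(i, j) 'X_(lshift 1 (mxvec_index i j)).
Definition gl_Y (K : nzRingType) r : gl_poly K r := 'X_(rshift (r * r) ord0).

(** Every variable is an entry of [gl_X] or is [gl_Y], and a polynomial is a sum of products of
    constants and variables. This reduces surjectivity onto a quotient to the generators. *)
Lemma gl_polyP (K : comNzRingType) r (P : gl_poly K r -> Prop) :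
  (forall c, P c%:MP) -> (forall i j, P (gl_X K r i j)) -> P (gl_Y K r) ->
  (forall p q, P p -> P q -> P (p + q)) ->
  (forall p q, P p -> P q -> P (p * q)) -> forall p, P p.
Proof.
move=> PC PX PY PD PM p; have P1 : P 1 by apply: PC.
have PV k : P 'X_k.
  case: (split_ordP k) => [k' ->|k' ->]; last by rewrite ord1.
  by case/mxvec_indexP: k' => i j; have:= PX i j; rewrite mxE.
rewrite [p]mpolyE; elim/big_rec: _ => [|m q _ Pq]; first exact: (PC 0).
apply: PD => //; rewrite -mul_mpolyC mpolyXE_id; apply: (PM) => //.
elim/big_rec: _ => // k t _ Pt; apply: (PM) => //.
by elim: (m k) => [|d IHd]; rewrite ?exprS //; apply: PM.
Qed.

Section GlEval.
Variables (K : comNzRingType) (S : comPzRingType) (r : nat).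
Variables (f : {rmorphism K -> S}) (g : 'M[S]_r) (y : S).

Lemma gl_eval_zmod : zmod_morphism (gl_eval f g y).
Proof. exact: mpoly_eval_zmod. Qed.

Lemma gl_eval_monoid : monoid_morphism (gl_eval f g y).
Proof. exact: mpoly_eval_monoid. Qed.

HB.instance Definition _ := GRing.isZmodMorphism.Build
  (gl_poly K r) S (gl_eval f g y) gl_eval_zmod.
HB.instance Definition _ := GRing.isMonoidMorphism.Build
  (gl_poly K r) S (gl_eval f g y) gl_eval_monoid.

Lemma gl_eval_X : map_mx (gl_eval f g y) (gl_X K r) = g.
Proof.
by apply/matrixP=> i j; rewrite !mxE /gl_eval mpoly_evalX gl_point_entry.
Qed.

Lemma gl_eval_Y : gl_eval f g y (gl_Y K r) = y.
Proof. by rewrite /gl_eval mpoly_evalX gl_point_inv. Qed.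

Lemma gl_evalC c : gl_eval f g y c%:MP = f c.
Proof. exact: mpoly_evalC. Qed.

(** Cramer's rule: [gl_Y *: \adj gl_X] is one polynomial formula for the inverse, valid at every
    point of GL_r. It serves both at Psi and at Psi gam. *)
Lemma gl_eval_inv : y * \det g = 1 ->
  map_mx (gl_eval f g y) (gl_Y K r *: \adj (gl_X K r)) *m g = 1%:M.
Proof.
move=> yg.
rewrite map_mxZ map_mx_adj gl_eval_X /= gl_eval_Y -scalemxAl mul_adj_mx.
by rewrite scale_scalar_mx yg.
Qed.

End GlEval.

(** * The coordinate ring of Gamma inside L (x)_E L *)

Section GammaPoints.
Variables (T : sigma_triple) (r : nat) (Psi : 'M[st_L T]_r).
Local Notation F := (st_F T).
Local Notation E := (st_E T).
Local Notation L := (st_L T).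
Local Notation LF := (restr (st_inc T) L).
Local Notation LL := (tens L L).
Local Notation ev := (gl_eval (@base_LL T) (Z_mx Psi) (Z_invdet Psi)).
Local Notation gproj := (gamma_proj Psi).

Lemma gamma_projP (x : gamma_alg Psi) : exists h, x = gproj h.
Proof. by exists (repr x); rewrite /gamma_proj reprK. Qed.

Lemma gamma_projE h k : (gproj h == gproj k) = (h - k \in gamma_ker Psi).
Proof. by rewrite Quotient.idealrBE. Qed.

(** The embedding of F[Gamma] into L (x)_E L induced by X |-> Z. The choice of representative is
    harmless, since two of them differ by an element of the kernel. *)
Definition gamma_ev (x : gamma_alg Psi) : LL := ev (repr x).

Lemma gamma_evE h : gamma_ev (gproj h) = ev h.
Proof.
have : gproj (repr (gproj h)) == gproj h by rewrite /gamma_proj reprK.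
by rewrite gamma_projE => /asboolP; rewrite raddfB => /eqP; rewrite subr_eq0 => /eqP.
Qed.

Lemma gamma_ev_inj : injective gamma_ev.
Proof.
move=> x y; have [h ->] := gamma_projP x; have [k ->] := gamma_projP y.
rewrite !gamma_evE => hk; apply/eqP; rewrite gamma_projE; apply/asboolP.
by rewrite raddfB /= hk subrr.
Qed.

Lemma gamma_evD x y : gamma_ev (x + y) = gamma_ev x + gamma_ev y.
Proof.
have [h ->] := gamma_projP x; have [k ->] := gamma_projP y.
by rewrite -rmorphD !gamma_evE raddfD.
Qed.

Lemma gamma_evZ a x : gamma_ev (a *: x) = @base_LL T a * gamma_ev x.
Proof.
have [h ->] := gamma_projP x.
have -> : a *: gproj h = gproj (a%:MP * h) by rewrite (rmorphM gproj).
by rewrite !gamma_evE rmorphM /= gl_evalC.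
Qed.

(* Gamma is a closed subscheme of Spec (L (x)_E L), which lies over L: this
   makes a (x) l |-> a(Z) (1 (x) l) a well-defined map to L (x)_E L, and it is
   injective on the elements a (x) 1. *)
Lemma gamma_inl_inj : injective (@tens_inl F (gamma_alg Psi) LF).
Proof.
pose f (a : gamma_alg Psi) (l : LF) : LL := gamma_ev a * tens_inr L (l : L).
have fP : balanced f.
  split=> [a a' l|a l l'|c a l]; rewrite /f ?gamma_evD ?mulrDl //.
    by rewrite -mulrDr -(rmorphD (@tens_inr E L L)).
  (* A scalar of F acts on L (x)_E L through E, so it may be moved from the left factor to the right
     one. *)
  rewrite gamma_evZ mulrAC mulrC; congr (_ * _).
  rewrite [@base_LL T c]/(pure _ 1) /tens_inr pureM mulr1 mul1r.
  rewrite [in_alg _ _]/(_ *: 1).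
  by have [_ _ ->] := balanced_pure L L.
move=> a b /(congr1 (tens_lift f)); rewrite !tens_lift_pure // /f.
by rewrite rmorph1 !mulr1 => /gamma_ev_inj.
Qed.

(** The relation is checked in L (x)_E L, where the determinants of Psi and Psi^-1 cancel separately
    in each tensor factor. *)
Lemma gamma_invdet_det : Psi \in unitmx ->
  gproj (gl_Y F r) * \det (map_mx gproj (gl_X F r)) = 1.
Proof.
move=> uP; rewrite det_map_mx -rmorphM; apply: gamma_ev_inj.
rewrite -(rmorph1 gproj) !gamma_evE rmorphM /= rmorph1 gl_eval_Y.
rewrite -det_map_mx gl_eval_X /Z_invdet /Z_mx det_mulmx !det_map_mx mulrACA.
have d1 : \det Psi * \det (invmx Psi) = 1 by rewrite -det_mulmx mulmxV ?det1.
by rewrite -!rmorphM d1 mulrC [\det _ * _]mulrC d1 !rmorph1 mulr1.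
Qed.

End GammaPoints.

Lemma pure_suml (K : comPzRingType) (A W : lmodType K) I (s : seq I)
    (a : I -> A) (w : W) :
  pure (\sum_(i <- s) a i) w = \sum_(i <- s) pure (a i) w.
Proof.
have pP := balanced_pure A W; have [pDl _ _] := pP.
exact: (big_morph (fun x => pure x w) (fun x y => pDl x y w) (balanced0l pP w)).
Qed.

Lemma pure_sumr (K : comPzRingType) (A W : lmodType K) I (s : seq I)
    (a : A) (w : I -> W) :
  pure a (\sum_(i <- s) w i) = \sum_(i <- s) pure a (w i).
Proof.
have [_ pDr _] := balanced_pure A W; apply: (big_morph (pure a) (pDr a)).
by apply: (addrI (pure a 0)); rewrite -pDr !addr0.
Qed.

(** * Coordinates in A (x)_K W along a basis of W *)

Section TensorBasis.
Variables (K : fieldType) (A W : lmodType K) (n : nat) (b : 'I_n -> W).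
Hypothesis bP : is_basis b.

Lemma tens_basis_span (x : tens A W) :
  exists a : 'I_n -> A, x = \sum_i pure (a i) (b i).
Proof.
have [pDl _ pZ] := balanced_pure A W.
elim/tens_ind: x => [|x y [a ->] [a' ->]|l w].
- exists (fun=> 0); rewrite big1 // => i _.
  exact: balanced0l (balanced_pure A W) _.
- exists (fun i => a i + a' i); rewrite -big_split; apply: eq_bigr => i _.
  by rewrite pDl.
have [c [-> _]] := bP w; exists (fun i => c 0 i *: l).
by rewrite pure_sumr; apply: eq_bigr => i _; rewrite pZ.
Qed.

(** With w_j the j-th coordinate of w, the balanced map (l, w) |-> w_j l induces a map A (x) W -> A
    that reads off the j-th coefficient. *)
Lemma tens_basis_free (a a' : 'I_n -> A) :
  \sum_i pure (a i) (b i) = \sum_i pure (a' i) (b i) -> a =1 a'.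
Proof.
have /choice [c cP] : forall w, exists c : 'rV_n, w = \sum_(i < n) c 0 i *: b i.
  by move=> w; have [c [wE _]] := bP w; exists c.
(* Uniqueness of coordinates; it makes the chosen function [c] linear and computes it on the
   basis. *)
have cI w (d : 'rV_n) : w = \sum_(i < n) d 0 i *: b i -> c w = d.
  by move=> wE; have [e [_ eP]] := bP w; rewrite -(eP _ (cP w)) (eP _ wE).
move=> aa' j; pose f (l : A) w := c w 0 j *: l.
have fP : balanced f.
  split=> [l l' w|l w w'|d l w]; rewrite /f ?scalerDr //.
    rewrite -scalerDl; congr (_ *: _).
    rewrite (cI _ (c w + c w')) ?mxE // {1}[w]cP {1}[w']cP -big_split /=.
    by apply: eq_bigr => i _; rewrite mxE scalerDl.
  rewrite scalerA mulrC; congr (_ *: _).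
  rewrite (cI (d *: w) (d *: c w)) ?mxE // {1}[w]cP scaler_sumr.
  by apply: eq_bigr => i _; rewrite mxE scalerA.
have fE (e : 'I_n -> A) : tens_lift f (\sum_i pure (e i) (b i)) = e j.
  rewrite (big_morph _ (fun x y => lift_add x y fP) (lift_zero fP)).
  rewrite (bigD1 j) //= big1 ?addr0 => [|i ij].
    rewrite tens_lift_pure // /f (cI _ (delta_mx 0 j)); last first.
      rewrite (bigD1 j) //= big1 ?addr0 ?mxE ?eqxx ?scale1r // => i /negPf ij.
      by rewrite mxE ij scale0r.
    by rewrite mxE !eqxx scale1r.
  rewrite tens_lift_pure // /f (cI _ (delta_mx 0 i)) ?mxE.
    by rewrite eq_sym (negPf ij) scale0r.
  rewrite (bigD1 i) //= big1 ?addr0 ?mxE ?eqxx ?scale1r // => k /negPf ki.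
  by rewrite mxE ki scale0r.
by rewrite -(fE a) aa' fE.
Qed.

End TensorBasis.

(** * The basis Psi^-1 m of V(M) *)

Section SolutionBasis.
Variables (T : sigma_triple) (M : phi_mod (st_sigE T)) (r : nat).
Local Notation F := (st_F T).
Local Notation E := (st_E T).
Local Notation L := (st_L T).
Local Notation LF := (restr (st_inc T) L).
Variables (m : 'I_r -> M) (Phi : 'M[E]_r) (Psi : 'M[L]_r).
Hypotheses (mP : is_basis m) (uPsi : Psi \in unitmx).
Hypothesis phi_m : forall i, pm_phi (m i) = \sum_(j < r) Phi i j *: m j.
Hypothesis sigPsi : map_mx (st_sigL T) Psi = map_mx (in_alg L) Phi *m Psi.

(** In the basis m, phi acts on coordinate rows by a |-> sigma(a) Phi, so solutions are the rows
    with sigma(a) Phi = a. *)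
Lemma phiL_row (a : 'rV[L]_r) :
  phiL (\sum_i pure (a 0 i) (m i) : tens L M) =
  \sum_i pure ((map_mx (st_sigL T) a *m map_mx (in_alg L) Phi) 0 i) (m i).
Proof.
have [_ _ pZ] := balanced_pure L M.
have phi0 : phiL (0 : tens L M) = 0.
  by apply: (addrI (phiL 0)); rewrite -phiLD !addr0.
rewrite (big_morph _ (@phiLD T M) phi0).
under eq_bigr => i _ do rewrite phiL_pure phi_m pure_sumr.
rewrite exchange_big; apply: eq_bigr => j _.
rewrite mxE pure_suml.
apply: eq_bigr => i _.
by rewrite -pZ !mxE /= mulrC mulr_algl.
Qed.

(** Apply sigma to Psi^-1 Psi = 1 and substitute sigma(Psi) = Phi Psi. By [phiL_row], the rows of
    Psi^-1 are then coordinates of solutions. *)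
Lemma sigL_invPsi :
  map_mx (st_sigL T) (invmx Psi) *m map_mx (in_alg L) Phi = invmx Psi.
Proof.
rewrite -[RHS]mul1mx; apply: (canRL (mulmxK uPsi)).
by rewrite -mulmxA -sigPsi -map_mxM mulVmx // map_mx1.
Qed.

Lemma sol_basis_subproof k :
  (\sum_i pure (invmx Psi k i) (m i) : tens L M) \in @is_sol T M.
Proof.
apply/asboolP; have := phiL_row (row k (invmx Psi)).
rewrite map_row -row_mul sigL_invPsi.
suff -> : \sum_i pure (row k (invmx Psi) 0 i) (m i) =
  \sum_i pure (invmx Psi k i) (m i) :> tens L M by [].
by apply: eq_bigr => i _; rewrite mxE.
Qed.

Definition sol_basis k : sol M := Sol (sol_basis_subproof k).

(** If a is the coordinate row of a solution, then sigma(a Psi) = sigma(a) Phi Psi = a Psi. Hence a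
    Psi has entries in L^sigma = F, and they are the coefficients sought because a = (a Psi)
    Psi^-1. *)
Lemma sol_basis_span (v : sol M) :
  exists c : 'I_r -> F, v = \sum_k c k *: sol_basis k.
Proof.
have [p0 pD] : sol_val (0 : sol M) = 0 /\ {morph @sol_val T M : x y / x + y}.
  by split.
have [a0 vE] := tens_basis_span mP (sol_val v : tens L M).
pose a := \row_i a0 i.
have {}vE : (sol_val v : tens L M) = \sum_i pure (a 0 i) (m i).
  by rewrite vE; apply: eq_bigr => i _; rewrite mxE.
have aE : map_mx (st_sigL T) a *m map_mx (in_alg L) Phi = a.
  apply/rowP; apply: (tens_basis_free mP).
  by rewrite -phiL_row -vE sol_valP.
have cE k : exists c, (a *m Psi) 0 k = (st_inc T c)%:A.
  apply/st_fixL; rewrite -[in RHS]aE -mulmxA -sigPsi -map_mxM.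
  by rewrite [in RHS]mxE.
have /choice [c {}cE] := cE; exists c; apply: val_inj => /=.
rewrite vE (big_morph _ pD p0) -[a](mulmxK uPsi).
under [RHS]eq_bigr => k _.
  have -> : sol_val (c k *: sol_basis k) =
      \sum_i pure ((st_inc T (c k))%:A * invmx Psi k i) (m i) :> tens L M.
    transitivity (st_inc T (c k) *: (sol_val (sol_basis k) : tens L M)) => //=.
    by rewrite scaler_sumr; apply: eq_bigr => i _; rewrite -pureZl mulr_algl.
  over.
rewrite exchange_big; apply: eq_bigr => i _.
rewrite mxE pure_suml.
by apply: eq_bigr => k _; rewrite cE.
Qed.

End SolutionBasis.

(** * Solutions over an F-algebra R and translation by a point of Gamma *)

Section BaseChange.
Variables (T : sigma_triple) (R : comAlgType (st_F T)).
Local Notation F := (st_F T).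
Local Notation E := (st_E T).
Local Notation L := (st_L T).
Local Notation LF := (restr (st_inc T) L).
Local Notation RL := (tens R LF).

Section Inclusion.
Variable N : phi_mod (st_sigE T).

Let j (a : R) (l : L) : RL_mod R := pure a (l : LF).

Let jD a : {morph j a : x y / x + y}.
Proof. by move=> x y; have [_ pDr _] := balanced_pure R LF; apply: pDr. Qed.

Let jZ a (c : E) x : j a (c *: x) = c *: j a x.
Proof.
rewrite /j -[c *: x]mulr_algl -{1}[a]mul1r.
exact: esym (@pureM F R LF 1 (c%:A : L) a x).
Qed.

Let idD : {morph @id N : x y / x + y}. Proof. by []. Qed.
Let idZ (c : E) (x : N) : c *: x = c *: x. Proof. by []. Qed.
Let jmD a := tens_mapD (jD a) idD (jZ a) idZ.
Let jm0 a := tens_map0 (jD a) idD (jZ a) idZ.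
Let jm_pure a := tens_map_pure (jD a) idD (jZ a) idZ.

(** Needed for [sol_incl] to be meaningful, as [tens_lift] computes correctly on balanced maps
    only. *)
Lemma balanced_sol_incl : balanced (fun (a : R) (v : sol N) =>
  tens_map (j a) id (sol_val v : tens L N) : tens (RL_mod R) N).
Proof.
have [pDl pDr pZ] := balanced_pure R LF.
have [qDl _ _] := balanced_pure (RL_mod R) N.
split=> [a a' v|a v w|c a v].
- elim/tens_ind: (sol_val v : tens L N) => [|x y IHx IHy|l n].
  + by rewrite !jm0 addr0.
  + by rewrite !jmD IHx IHy addrACA.
  + by rewrite !jm_pure -qDl; congr pure; apply: pDl.
- exact: jmD.
- change (sol_val (c *: v) : tens L N)
    with (st_inc T c *: (sol_val v : tens L N)).
  elim/tens_ind: (sol_val v : tens L N) => [|x y IHx IHy|l n].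
  + by rewrite scaler0 !jm0.
  + by rewrite scalerDr !jmD IHx IHy.
  + by rewrite -pureZl !jm_pure; congr pure; apply: pZ.
Qed.

Lemma sol_inclD (x y : tens R (sol N)) :
  sol_incl (x + y) = sol_incl x + sol_incl y.
Proof. exact: (lift_add _ _ balanced_sol_incl). Qed.

Lemma sol_incl0 : sol_incl (0 : tens R (sol N)) = 0.
Proof. exact: (lift_zero balanced_sol_incl). Qed.

Lemma sol_incl_pure (a : R) (v : sol N) I (s : seq I) (l : I -> L) (n : I -> N) :
  (sol_val v : tens L N) = \sum_(i <- s) pure (l i) (n i) ->
  sol_incl (pure a v) = \sum_(i <- s) pure (j a (l i)) (n i).
Proof.
move=> vE; rewrite /sol_incl tens_lift_pure; last exact: balanced_sol_incl.
rewrite -/(j a) vE (big_morph _ (jmD a) (jm0 a)).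
by apply: eq_bigr => i _; rewrite jm_pure.
Qed.

End Inclusion.

Variables (M : phi_mod (st_sigE T)) (r : nat).
Variables (m : 'I_r -> M) (Phi : 'M[E]_r) (Psi : 'M[L]_r).
Hypotheses (mP : is_basis m) (uPsi : Psi \in unitmx).
Hypothesis phi_m : forall i, pm_phi (m i) = \sum_(j < r) Phi i j *: m j.
Hypothesis sigPsi : map_mx (st_sigL T) Psi = map_mx (in_alg L) Phi *m Psi.
Local Notation v := (sol_basis uPsi phi_m sigPsi).
Local Notation inl := (@tens_inl F R LF).
Local Notation inr := (@tens_inr F R LF).

(** Since v = Psi^-1 m, [sol_incl] turns coordinates along v into coordinates along m by right
    multiplication with Psi^-1. *)
Lemma sol_incl_basis (a : 'rV[R]_r) :
  sol_incl (\sum_k pure (a 0 k) (v k)) =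
  \sum_i pure
    ((map_mx inl a *m map_mx inr (invmx Psi : 'M[LF]_r)) 0 i : RL_mod R) (m i).
Proof.
have vE k : (sol_val (v k) : tens L M) = \sum_i pure (invmx Psi k i) (m i) by [].
rewrite (big_morph _ (@sol_inclD M) (@sol_incl0 M)).
under eq_bigr => k _ do rewrite (sol_incl_pure _ (vE k)).
rewrite exchange_big; apply: eq_bigr => i _.
rewrite mxE (@pure_suml E (RL_mod R)).
by apply: eq_bigr => k _; rewrite !mxE /tens_inl /tens_inr pureM mulr1 mul1r.
Qed.

Lemma base_sol_span (x : tens R (sol M)) :
  exists a : 'rV[R]_r, x = \sum_k pure (a 0 k) (v k).
Proof.
have pP := balanced_pure R (sol M); have [pDl _ pZ] := pP.
elim/tens_ind: x => [|x y [a ->] [a' ->]|l w].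
- by exists 0; rewrite big1 // => i _; rewrite mxE; apply: balanced0l.
- exists (a + a'); rewrite -big_split; apply: eq_bigr => i _.
  by rewrite mxE pDl.
have [c ->] := sol_basis_span mP uPsi phi_m sigPsi w.
exists (\row_k (c k *: l)); rewrite pure_sumr.
by apply: eq_bigr => i _; rewrite mxE pZ.
Qed.

Hypothesis inl_inj : injective inl.

(** After [sol_incl], multiplying by Psi over R (x)_F L leaves a (x) 1 = a' (x) 1, and [inl_inj]
    descends this to R. For R = F[Gamma] that hypothesis is [gamma_inl_inj]. *)
Lemma base_sol_free (a a' : 'rV[R]_r) :
  \sum_k pure (a 0 k) (v k) = \sum_k pure (a' 0 k) (v k) -> a = a'.
Proof.
move/(congr1 (@sol_incl T R M)); rewrite !sol_incl_basis.
move/(tens_basis_free mP) => aa'.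
have {aa'} : map_mx inl a *m map_mx inr (invmx Psi : 'M[LF]_r) =
  map_mx inl a' *m map_mx inr (invmx Psi : 'M[LF]_r) by apply/rowP.
move/(congr1 (mulmx^~ (map_mx inr (Psi : 'M[LF]_r)))).
rewrite -!mulmxA -map_mxM mulVmx // map_mx1 !mulmx1 => aa'.
by apply/rowP => k; apply: inl_inj; move/rowP/(_ k): aa'; rewrite !mxE.
Qed.

(* Psi^-1 has its entries in Sigma, and translation by gam turns it into
   (Psi gam)^-1 = gam^-1 Psi^-1. *)
Lemma translation_basis (gam : {lrmorphism gamma_alg Psi -> R})
    (mu : sol M -> tens R (sol M)) (B : 'M[R]_r) :
  restricts_translation gam mu ->
  (forall k, mu (v k) = \sum_l pure (B k l) (v l)) ->
  gamma_invdet gam * \det (gamma_mx gam) = 1 ->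
  B *m gamma_mx gam = 1%:M.
Proof.
move=> muP muE dgam.
pose g := map_mx inr (Psi : 'M[LF]_r) *m map_mx inl (gamma_mx gam).
pose d := inr (\det (invmx Psi)) * inl (gamma_invdet gam).
(* [h] stands for X^-1: its value at Psi is Psi^-1, and its value at Psi gam is (Psi gam)^-1. *)
pose h := gl_Y E r *: \adj (gl_X E r).
have hPsi : map_mx (eval_Psi Psi) h = invmx Psi.
  rewrite -[RHS]mul1mx; apply: (canRL (mulmxK uPsi)).
  by apply: gl_eval_inv; rewrite -det_mulmx mulVmx // det1.
have hgam : map_mx (eval_Psi_gam gam) h *m g = 1%:M.
  apply: gl_eval_inv; rewrite det_mulmx !det_map_mx mulrACA -!rmorphM.
  by rewrite dgam -det_mulmx mulVmx // det1 !rmorph1 mulr1.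
(* Two computations of the coordinates of [sol_incl (mu (v k))] along m: from the matrix B, and by
   translating v_k = sum_i h_ki(Psi) (x) m_i. *)
have BE : map_mx inl B *m map_mx inr (invmx Psi : 'M[LF]_r) =
    map_mx (eval_Psi_gam gam) h.
  apply/row_matrixP => k; rewrite row_mul -map_row; apply/rowP.
  apply: (@tens_basis_free E (RL_mod R) M _ _ mP); rewrite -sol_incl_basis.
  under eq_bigr => l _ do rewrite mxE.
  rewrite -muE (muP _ [seq (h k i, m i) | i <- enum 'I_r]); last first.
    rewrite big_map big_enum; apply: eq_bigr => i _.
    by rewrite -hPsi mxE.
  by rewrite big_map big_enum; apply: eq_bigr => i _; rewrite !mxE.
apply/matrixP => i k; apply: inl_inj; move: i k.
have {}BE : map_mx inl B =
    map_mx (eval_Psi_gam gam) h *m map_mx inr (Psi : 'M[LF]_r).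
  by rewrite -BE -mulmxA -map_mxM mulVmx // map_mx1 mulmx1.
have {hgam} : map_mx inl (B *m gamma_mx gam) = 1%:M.
  by rewrite map_mxM BE -mulmxA.
by rewrite -(map_mx1 inl) => /matrixP BE1 i k; have:= BE1 i k; rewrite !mxE.
Qed.

End BaseChange.

(** * Extension and multiplication of scalars on sums of pure tensors *)

Section BaseMaps.
Variables (T : sigma_triple) (B R : comAlgType (st_F T)) (W : lmodType (st_F T)).

Lemma base_change_sum (f : {lrmorphism B -> R}) I (s : seq I) (a : I -> B)
    (w : I -> W) :
  base_change f (\sum_(i <- s) pure (a i) (w i)) =
  \sum_(i <- s) pure (f (a i)) (w i).
Proof.
have idD : {morph @id W : x y / x + y} by [].
have idZ (c : st_F T) (x : W) : c *: x = c *: x by [].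
have fP := tens_mapD (rmorphD f) idD (linearZZ f) idZ.
rewrite /base_change (big_morph _ fP (tens_map0 (rmorphD f) idD (linearZZ f) idZ)).
by apply: eq_bigr => i _; rewrite (tens_map_pure (rmorphD f) idD (linearZZ f) idZ).
Qed.

Lemma base_scale_sum (b : B) I (s : seq I) (a : I -> B) (w : I -> W) :
  base_scale b (\sum_(i <- s) pure (a i) (w i)) =
  \sum_(i <- s) pure (b * a i) (w i).
Proof.
have idD : {morph @id W : x y / x + y} by [].
have idZ (c : st_F T) (x : W) : c *: x = c *: x by [].
have bD : {morph *%R b : x y / x + y} := mulrDr b.
have bZ (c : st_F T) (x : B) : b * (c *: x) = c *: (b * x) by rewrite scalerAr.
rewrite /base_scale (big_morph _ (tens_mapD bD idD bZ idZ)
  (tens_map0 bD idD bZ idZ)).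
by apply: eq_bigr => i _; rewrite (tens_map_pure bD idD bZ idZ).
Qed.

Lemma base_change_pure (f : {lrmorphism B -> R}) (b : B) (w : W) :
  base_change f (pure b w) = pure (f b) w.
Proof.
by have := base_change_sum f [:: tt] (fun=> b) (fun=> w); rewrite !big_seq1.
Qed.

Lemma base_scale_pure (b a : B) (w : W) :
  base_scale b (pure a w) = pure (b * a) w.
Proof.
by have := base_scale_sum b [:: tt] (fun=> a) (fun=> w); rewrite !big_seq1.
Qed.

End BaseMaps.

(** * Surjectivity of the comorphism F[Gamma_M] -> F[Gamma] *)

Theorem theorem5p6 (T : sigma_triple) (M : phi_mod (st_sigE T)) (r : nat)
    (m : 'I_r -> M) (Phi : 'M[st_E T]_r) (Psi : 'M[st_L T]_r)
    (G : tannaka_group M)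
    (pi : {lrmorphism tg_alg G -> gamma_alg Psi}) :
  L_trivial M ->
  is_basis m ->
  Phi \in unitmx ->
  (forall i, pm_phi (m i) = \sum_(j < r) Phi i j *: m j) ->
  Psi \in unitmx ->
  map_mx (st_sigL T) Psi = map_mx (in_alg (st_L T)) Phi *m Psi ->
  is_pi pi ->
  closed_immersion pi.
Proof.
move=> _ mP _ phi_m uPsi sigPsi piP.
pose v := sol_basis uPsi phi_m sigPsi.
pose X := map_mx (gamma_proj Psi) (gl_X (st_F T) r).
pose Y := gamma_proj Psi (gl_Y (st_F T) r).
have YX : Y * \det X = 1 := gamma_invdet_det uPsi.
have inl_inj := @gamma_inl_inj T r Psi.
have span := base_sol_span mP uPsi phi_m sigPsi.
have free := @base_sol_free T _ M r m Phi Psi mP uPsi phi_m sigPsi inl_inj.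
have [/(_ M (tg_gen M)) [uD uZ [u' uK u'K]] _ _ _] := tg_univ_aut G.
have u0 : tg_univ G (0 : tens _ (sol M)) = 0.
  by apply: (addrI (tg_univ G 0)); rewrite -uD !addr0.
have /choice [b bE] k := span (tg_alg G) (tg_univ G (pure 1 (v k))).
have /choice [c cE] k := span (tg_alg G) (u' (pure 1 (v k))).
(* The matrices, over F[Gamma_M], of the universal automorphism of M and of its inverse in the basis
   v. *)
pose Bm := \matrix_(k, l) b k 0 l; pose Cm := \matrix_(k, l) c k 0 l.
have BX : map_mx pi Bm *m X = 1%:M.
  (* The universal point of Gamma, whose matrix is X itself. *)
  pose gam : {lrmorphism gamma_alg Psi -> gamma_alg Psi} := idfun.
  have XE : gamma_mx gam = X by apply/matrixP => i j; rewrite !mxE.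
  rewrite -XE.
  apply: (translation_basis (uPsi := uPsi) (phi_m := phi_m)
    (sigPsi := sigPsi) mP inl_inj (piP _ gam _ (tg_gen M))).
    move=> k; rewrite bE base_change_sum.
    by apply: eq_bigr => l _; rewrite !mxE.
  by rewrite XE.
(* Row k expresses u(u'(1 (x) v_k)) = 1 (x) v_k. Coefficients are compared after applying pi,
   because [free] gives the independence of v over F[Gamma]. *)
have CB : map_mx pi (Cm *m Bm) = 1%:M.
  apply/row_matrixP => k; apply: free.
  transitivity (base_change pi (pure 1 (v k))).
    rewrite -[pure 1 (v k)]u'K cE (big_morph _ uD u0).
    under [in RHS]eq_bigr => l _ do
      rewrite -[c k 0 l]mulr1 -base_scale_pure uZ bE base_scale_sum.
    rewrite exchange_big.
    under [in RHS]eq_bigr => l _ do rewrite -pure_suml.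
    rewrite base_change_sum; apply: eq_bigr => l _.
    rewrite !mxE; congr (pure (pi _) _); apply: eq_bigr => i _.
    by rewrite !mxE.
  rewrite base_change_pure rmorph1 (bigD1 k) //= big1 => [|l /negPf lk].
    by rewrite addr0 !mxE eqxx.
  by rewrite !mxE eq_sym lk; apply: balanced0l (balanced_pure _ _) _.
have CX : map_mx pi Cm = X.
  by rewrite -[LHS]mulmx1 -BX mulmxA -map_mxM CB mul1mx.
(* From pi(B) X = 1 and Y det X = 1, both pi(det B) and Y are the inverse of det X. *)
have YB : pi (\det Bm) = Y.
  by rewrite -[RHS]mulr1 -(det1 _ r) -BX det_mulmx mulrCA YX mulr1 det_map_mx.
move=> x; have [h ->] := gamma_projP x; elim/gl_polyP: h.
- move=> e; exists (e *: 1); rewrite linearZ rmorph1; apply: mulr1.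
- by move=> i j; exists (Cm i j); move/matrixP/(_ i j): CX; rewrite !mxE.
- by exists (\det Bm).
- by move=> p q [a aE] [a' a'E]; exists (a + a'); rewrite !rmorphD /= aE a'E.
- by move=> p q [a aE] [a' a'E]; exists (a * a'); rewrite !rmorphM /= aE a'E.
Qed.
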